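(* DC2 does not imply DC1 on dendrites, that is: (i) there exist a dendrite $X$ and a continuous map $f:X\to X$ such that $f$ has a DC2 pair but no DC1 pair; and (ii) there exist a dendrite $X$ and a continuous map $f:X\to X$ such that $f$ has an uncountable DC2 set but no uncountable DC1 set.
   Context: A dendrite is a locally connected continuum (compact connected metric space) containing no subset homeomorphic to the circle. Let $(X,d)$ be a compact metric space and $f:X\to X$ continuous. For $x,y\in X$ and $\delta>0$ put $$\Phi_{(f,x,y)}(\delta)=\liminf_{n\to\infty}\frac1n\#\{0\le k\le n: d(f^k(x),f^k(y))<\delta\},\qquad \Phi^*_{(f,x,y)}(\delta)=\limsup_{n\to\infty}\frac1n\#\{0\le k\le n: d(f^k(x),f^k(y))<\delta\}.$$ A pair $(x,y)\in X^2$ is a DC1 pair if $\Phi^*_{(f,x,y)}(\delta)=1$ for every $0<\delta\le \operatorname{diam}X$ and $\Phi_{(f,x,y)}(\epsilon)=0$ for some $0<\epsilon\le\operatorname{diam}X$. It is a DC2 pair if $\Phi^*_{(f,x,y)}(\delta)=1$ for every $0<\delta\le \operatorname{diam}X$ and $\Phi_{(f,x,y)}(\epsilon)<1$ for some $0<\epsilon\le\operatorname{diam}X$. For $i\in\{1,2\}$, a set $S\subset X$ is a DC$i$ set if every pair of distinct points of $S$ is a DC$i$ pair. *)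

(* Defs.v *)
From mathcomp Require Import all_boot all_order all_algebra.
From mathcomp Require Import all_classical all_reals all_analysis.
Import Order.TTheory GRing.Theory Num.Theory.
Import numFieldTopology.Exports numFieldNormedType.Exports.

Set Implicit Arguments.
Unset Strict Implicit.
Unset Printing Implicit Defensive.

Local Open Scope classical_set_scope.
Local Open Scope ring_scope.

(* The subspaces A of T and B of U are homeomorphic; [f] and [g] are total
   functions, but only their restrictions to A and B matter. *)
Definition homeomorphic_sets (T U : topologicalType) (A : set T) (B : set U) :=
  exists (f : T -> U) (g : U -> T),
    [/\ {within A, continuous f} /\ {within B, continuous g},
        {homo f : x / A x >-> B x} /\ {homo g : y / B y >-> A y},
        (forall x, A x -> g (f x) = x) &
        (forall y, B y -> f (g y) = y)].

Definition unit_circle (R : realType) : set (R * R) :=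
  [set p | p.1 ^+ 2 + p.2 ^+ 2 = 1].

Definition locally_connected (T : topologicalType) :=
  forall (x : T) (U : set T), nbhs x U ->
    exists V : set T, [/\ open V, V x, connected V & V `<=` U].

(* A [metricType] may be empty, whereas a continuum is nonempty. *)
Definition continuum (R : realType) (X : metricType R) :=
  [/\ [set: X] !=set0, compact [set: X] & connected [set: X]].

Definition dendrite (R : realType) (X : metricType R) :=
  [/\ continuum X, locally_connected X &
      ~ exists C : set X, homeomorphic_sets (@unit_circle R) C].

(* This supremum is finite when X is compact, which the definitions below presuppose. *)
Definition diam (R : realType) (X : metricType R) : R :=
  sup [set mdist p.1 p.2 | p in [set: X * X]].

Section distributional_chaos.
Context {R : realType} {X : metricType R}.
Implicit Types (f : X -> X) (x y : X) (S : set X).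

(* The term of index 0 is 0 (as 0^-1 = 0); it does not affect the limits. *)
Definition close_freq f x y (delta : R) : R^nat := fun n =>
  n%:R^-1 *
  #|[pred k : 'I_n.+1 | mdist (iter k f x) (iter k f y) < delta]|%:R.

(* [close_freq] takes values in [0, 2], so these real-valued limits are the
   actual lower and upper limits. *)
Definition Phi_inf f x y (delta : R) : R := limn_inf (close_freq f x y delta).
Definition Phi_sup f x y (delta : R) : R := limn_sup (close_freq f x y delta).

Definition DC1_pair f x y :=
  (forall delta : R, 0 < delta -> delta <= diam X -> Phi_sup f x y delta = 1) /\
  (exists eps : R, [/\ 0 < eps, eps <= diam X & Phi_inf f x y eps = 0]).

Definition DC2_pair f x y :=
  (forall delta : R, 0 < delta -> delta <= diam X -> Phi_sup f x y delta = 1) /\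
  (exists eps : R, [/\ 0 < eps, eps <= diam X & Phi_inf f x y eps < 1]).

Definition DC1_set f S :=
  forall x y, S x -> S y -> x <> y -> DC1_pair f x y.

Definition DC2_set f S :=
  forall x y, S x -> S y -> x <> y -> DC2_pair f x y.

End distributional_chaos.

(* Main.v *)
Require Import Defs.
From HB Require Import structures.
From mathcomp Require Import all_boot all_order all_algebra.
From mathcomp Require Import all_classical all_reals all_analysis.
From mathcomp Require Import zify ring lra.
Import Order.TTheory GRing.Theory Num.Theory.
Import numFieldTopology.Exports numFieldNormedType.Exports.

Set Implicit Arguments.
Unset Strict Implicit.
Unset Printing Implicit Defensive.

Local Open Scope classical_set_scope.
Local Open Scope ring_scope.

(** One system proves both parts: a dendrite with a map that has an uncountable
DC2 set but no DC1 pair at all.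

The ends of the dendrite form a shift-invariant closed set [windowed] of binary
sequences. For every [m], a member of it vanishes on windows of length [m] that
start at all the times of some residue class modulo [period m]. Consecutive
periods are coprime, so by the Chinese remainder theorem the [m]-windows of one
member and the [m.+1]-windows of any other one meet along a residue class
([windowed_common]). Hence any two members agree on windows of any given length
with positive lower frequency, which excludes DC1 pairs.

The periods grow so fast that windows placed just before the multiples of
[period m], for all [m] at once, cover at most half of every initial segment of
times ([count_admissible]); at the remaining times the values can be prescribed
freely. The sequence [coded c] spends one bit of [c] on each block of times
from [m`!] to [m.+1`!], every bit being used for infinitely many blocks. Each
block is much longer than all the earlier ones together. At the end of a
block that carries the bit [c 0], which is always false, two such sequences have
therefore agreed almost all of the time ([count_close_coded]); at the end of a
block that carries a bit on which [c] and [d] differ, they have disagreed about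
half of the time ([count_far_coded]). So they form a DC2 pair.

Over every nonempty closed set [E] of binary sequences that is stable under
replacing ones by zeros, [tree E] is a dendrite. Its points lie at heights
between 0, where they correspond to the members of [E] and are called ends, and
1, where there is only the apex; two branches separate at height 2^-j, where [j]
is the first index at which they differ.
This is an R-tree: geodesics stay in balls, which gives connectedness and
local connectedness ([ball_connected]); it is compact as a continuous image of
a closed subset of the Cantor space times [0, 1] ([tree_compact]); and it
contains no circle because every two points are separated by the removal of a
single point, whereas a circle stays connected ([no_circle_of_cuts]). The shift
extends to the tree by doubling the heights ([tree_shift]). A point of positive
height reaches the apex in finite time, so two such points eventually coincide,
while such a point and an end are eventually at distance 1: no DC1 pair arises
outside the set of ends ([no_DC1_pair]). *)

(** * An ultrametric on binary sequences *)

Lemma le_max3 (R : realType) (u v w : R) :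
  [/\ u <= Num.max (Num.max u v) w, v <= Num.max (Num.max u v) w &
      w <= Num.max (Num.max u v) w].
Proof. by rewrite !le_max !lexx !orbT. Qed.

Lemma ge_max3 (R : realType) (r u v w : R) :
  u <= r -> v <= r -> w <= r -> Num.max (Num.max u v) w <= r.
Proof. by move=> h1 h2 h3; rewrite !ge_max h1 h2 h3. Qed.

Section first_difference.
Variable R : realType.
Implicit Types a b c : nat -> bool.

Definition wt (j : nat) : R := 2^-1 ^+ j.

Lemma wt_gt0 j : 0 < wt j.
Proof. by rewrite exprn_gt0 // invr_gt0. Qed.

Lemma wt0 : wt 0 = 1.
Proof. by rewrite /wt expr0. Qed.

Lemma wtS j : wt j = 2 * wt j.+1.
Proof. by rewrite /wt exprS mulrA divff ?mul1r // pnatr_eq0. Qed.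

Lemma le_wt i j : (i <= j)%N -> wt j <= wt i.
Proof.
by move=> ij; rewrite /wt ler_wiXn2l ?invr_ge0 // invf_le1 // ler1n.
Qed.

Lemma wt_le1 j : wt j <= 1.
Proof. by rewrite -wt0 le_wt. Qed.

Lemma wt_small e : 0 < e -> exists N, forall j, (N <= j)%N -> wt j < e.
Proof.
move=> e0.
have : wt n @[n --> \oo] --> (0 : R).
  by apply: cvg_expr; rewrite ger0_norm ?invr_ge0 // invf_lt1 // ltr1n.
move=> /cvgrPdist_lt /(_ e e0) [N _ hN]; exists N => j /hN /=.
by rewrite sub0r normrN ger0_norm // ltW // wt_gt0.
Qed.

(** The weight of the first index at which the sequences differ, or 0: the
supremum form yields [sdist_le] without searching for that index. *)
Definition sdist a b : R := sup ([set 0] `|` [set wt j | j in [set j | a j <> b j]]).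

Lemma sdist_has_sup a b :
  has_sup ([set 0] `|` [set wt j | j in [set j | a j <> b j]]).
Proof.
split; first by exists 0; left.
exists 1 => _ [->|[j _ <-]]; [exact: ler01 | exact: wt_le1].
Qed.

Lemma wt_le_sdist a b j : a j <> b j -> wt j <= sdist a b.
Proof. by move=> ab; apply: ub_le_sup; [case: (sdist_has_sup a b)|right; exists j]. Qed.

Lemma sdist_ge0 a b : 0 <= sdist a b.
Proof. by apply: ub_le_sup; [case: (sdist_has_sup a b)|left]. Qed.

Lemma sdist_le r a b : 0 <= r -> (forall j, a j <> b j -> wt j <= r) -> sdist a b <= r.
Proof.
move=> r0 h; apply: ge_sup; first by case: (sdist_has_sup a b).
by move=> _ [->|[j /h ? <-]].
Qed.

Lemma sdist_le1 a b : sdist a b <= 1.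
Proof. by apply: sdist_le => // j _; exact: wt_le1. Qed.

Lemma sdistxx a : sdist a a = 0.
Proof. by apply/eqP; rewrite eq_le sdist_ge0 andbT sdist_le. Qed.

Lemma sdistC a b : sdist a b = sdist b a.
Proof.
by apply/eqP; rewrite eq_le; apply/andP; split; apply: sdist_le (sdist_ge0 _ _) _
  => j ab; apply: wt_le_sdist => /esym.
Qed.

Lemma sdist_ultra r a b c : sdist a b <= r -> sdist b c <= r -> sdist a c <= r.
Proof.
move=> ab bc; apply: sdist_le => [|j ac]; first exact: le_trans (sdist_ge0 _ _) ab.
have [eab|/eqP nab] := eqVneq (a j) (b j); last exact: le_trans (wt_le_sdist nab) ab.
by apply: le_trans bc; apply: wt_le_sdist; rewrite -eab.
Qed.

Lemma sdist_val a b : sdist a b = 0 \/ exists j, sdist a b = wt j.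
Proof.
have [h|/existsNP[j0 /eqP hj0]] := pselect (forall j, a j = b j).
  left; apply/eqP; rewrite eq_le sdist_ge0 andbT.
  by apply: sdist_le => // j; rewrite h.
have ex : exists j, a j != b j by exists j0.
case: (ex_minnP ex) => j /eqP jab jmin; right; exists j.
apply/eqP; rewrite eq_le wt_le_sdist // andbT; apply: sdist_le; first exact/ltW/wt_gt0.
by move=> i /eqP /jmin ij; exact: le_wt.
Qed.

Lemma sdist_shift a b :
  sdist (fun j => a j.+1) (fun j => b j.+1) <= 2 * sdist a b.
Proof.
apply: sdist_le => [|j ab]; first by rewrite mulr_ge0 ?sdist_ge0.
by rewrite wtS ler_pM2l // wt_le_sdist.
Qed.

(** The weights are the heights of the branch points, so a level that is not a
weight lies inside an edge of the tree. The midpoint works unless it is itself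
a weight; then a slightly lower point lies strictly between two consecutive
weights. *)
Lemma nonweight_between (u v : R) : 0 <= u -> u < v ->
  exists s, [/\ u < s, s < v & forall j, s <> wt j].
Proof.
move=> u0 uv; pose s1 := (u + v) / 2.
have us1 : u < s1 by rewrite /s1; lra.
have s1v : s1 < v by rewrite /s1; lra.
have [[j s1j]|nj] := pselect (exists j, s1 = wt j); last first.
  by exists s1; split=> // j s1j; apply: nj; exists j.
pose m := Num.max u (wt j.+1).
have ms1 : m < s1 by rewrite gt_max us1 s1j (wtS j); have := wt_gt0 j.+1; lra.
have um : u <= m by rewrite le_max lexx.
have wm : wt j.+1 <= m by rewrite le_max lexx orbT.
exists ((m + s1) / 2); split; [lra|lra|move=> i ei].
have [ij|ji] := leqP i j.
  by have := le_wt ij; lra.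
by have := le_wt ji; lra.
Qed.

End first_difference.
Arguments sdist {R}.
Arguments wt {R}.

(** * The tree over a set of binary sequences *)

Section tree.
Variables (R : realType) (E : set (nat -> bool)).

(** Below its height a point remembers nothing of the branch it lies on: the
entries of [branch] whose weight is at most [height] are set to false. This
chooses one representative in each class of (branch, height) pairs that denote
the same point, and avoids a quotient. *)
Record tree := Tree {
  branch : nat -> bool;
  height : R;
  branch_in : E branch;
  height_ge0 : 0 <= height;
  height_le1 : height <= 1;
  branch_cut : forall j, wt j <= height -> branch j = false }.

HB.instance Definition _ := gen_eqMixin tree.
HB.instance Definition _ := gen_choiceMixin tree.

Implicit Types x y z : tree.

Definition meet_height x y : R :=
  Num.max (Num.max (height x) (height y)) (sdist (branch x) (branch y)).

Lemma meet_height_le r x y : height x <= r -> height y <= r ->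
  sdist (branch x) (branch y) <= r -> meet_height x y <= r.
Proof. by move=> hx hy hr; rewrite /meet_height !ge_max hx hy hr. Qed.

Lemma meet_height_ge x y : [/\ height x <= meet_height x y,
  height y <= meet_height x y & sdist (branch x) (branch y) <= meet_height x y].
Proof. exact: le_max3. Qed.

Lemma meet_heightC x y : meet_height x y = meet_height y x.
Proof. by rewrite /meet_height sdistC (maxC (height x)). Qed.

Lemma meet_height_le1 x y : meet_height x y <= 1.
Proof. by apply: meet_height_le; rewrite ?height_le1 ?sdist_le1. Qed.

(** The length of the path that climbs from [x] to the meet and goes down to [y]. *)
Definition tree_dist x y : R := 2 * meet_height x y - height x - height y.

Lemma tree_eq x y : branch x = branch y -> height x = height y -> x = y.
Proof.
case: x y => [a u p1 p2 p3 p4] [b v q1 q2 q3 q4] /= ab uv.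
by subst b v; congr Tree; exact: Prop_irrelevance.
Qed.

Lemma tree_distxx x : tree_dist x x = 0.
Proof.
have [h _ _] := meet_height_ge x x.
have : meet_height x x <= height x.
  by apply: meet_height_le; rewrite ?sdistxx ?height_ge0.
by rewrite /tree_dist; lra.
Qed.

Lemma tree_dist_eq0 x y : tree_dist x y = 0 -> x = y.
Proof.
rewrite /tree_dist => d0; have [h1 h2 h3] := meet_height_ge x y.
have exy : height x = height y by lra.
apply: tree_eq => //; apply/funext => j.
have [hj|hj] := leP (wt j) (height x).
  by rewrite !branch_cut // -exy.
apply: contrapT => /(@wt_le_sdist R) hr; move: (le_trans hr h3) hj d0; lra.
Qed.

Lemma tree_distC x y : tree_dist x y = tree_dist y x.
Proof. by rewrite /tree_dist meet_heightC; lra. Qed.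

Lemma tree_dist_triangle y x z : tree_dist x z <= tree_dist x y + tree_dist y z.
Proof.
have [a1 a2 a3] := meet_height_ge x y; have [b1 b2 b3] := meet_height_ge y z.
rewrite /tree_dist.
suff : meet_height x z <= meet_height x y + meet_height y z - height y by lra.
apply: meet_height_le; [lra|lra|].
by apply: (@sdist_ultra _ _ _ (branch y)); lra.
Qed.

HB.instance Definition _ := @isMetric.Build R tree tree_dist tree_distxx
  tree_dist_eq0 tree_distC tree_dist_triangle.

Lemma mdistE x y : mdist x y = 2 * meet_height x y - height x - height y.
Proof. by []. Qed.

(** Cutting a branch at some height must give a member of [E] again. *)
Hypothesis E_hereditary : forall a b : nat -> bool, E a -> (forall j, b j -> a j) -> E b.

Definition clip (u : R) : R := Num.max 0 (Num.min 1 u).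

Lemma clip_ge0 u : 0 <= clip u. Proof. by rewrite /clip le_max lexx. Qed.
Lemma clip_le1 u : clip u <= 1.
Proof. by rewrite /clip ge_max ler01 ge_min lexx. Qed.
Lemma clip_id u : 0 <= u -> u <= 1 -> clip u = u.
Proof. by move=> u0 u1; rewrite /clip (min_idPr u1) (max_idPr u0). Qed.
Lemma clip_dist u v : `|clip u - clip v| <= `|u - v|.
Proof.
rewrite /clip; case: (leP 1 u) => h1; case: (leP 1 v) => h2;
  rewrite ?(max_idPr (@ler01 R)); case: (leP 0 u) => h3; case: (leP 0 v) => h4;
  rewrite ler_norml; apply/andP; split; case: (leP 0 (u - v)) => h;
  rewrite ?(ger0_norm h) ?(ltr0_norm h); lra.
Qed.

Definition truncate (a : nat -> bool) (u : R) := fun j => a j && ~~ (wt j <= u).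

Lemma truncate_in a u : E a -> E (truncate a u).
Proof. by move=> /E_hereditary; apply => j /andP[]. Qed.

Lemma truncate_cut a (u : R) j : wt j <= u -> truncate a u j = false.
Proof. by rewrite /truncate => ->; rewrite andbF. Qed.

Definition ray a (Ea : E a) (u : R) : tree :=
  Tree (truncate_in (clip u) Ea) (clip_ge0 u) (clip_le1 u) (@truncate_cut a (clip u)).

(** Cutting a branch at height [u] only forgets entries of weight at most [u],
which the maximum hides. *)
Lemma meet_ray a b (Ea : E a) (Eb : E b) u v :
  meet_height (ray Ea u) (ray Eb v) =
  Num.max (Num.max (clip u) (clip v)) (sdist a b).
Proof.
have cutr c w r : clip w <= r -> sdist c (truncate c (clip w)) <= r.
  move=> wr; apply: sdist_le => [|j]; first exact: le_trans (clip_ge0 w) wr.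
  rewrite /truncate; case: (leP (wt j) (clip w)) => [h _|_]; first exact: le_trans wr.
  by rewrite andbT.
have [m1 m2 m3] := le_max3 (clip u) (clip v) (sdist a b).
apply/eqP; rewrite eq_le; apply/andP; split.
  apply: meet_height_le => //=.
  apply: (@sdist_ultra _ _ _ a); first by rewrite sdistC; exact: cutr.
  by apply: (@sdist_ultra _ _ _ b) => //; exact: cutr.
have [/= h1 h2 h3] := meet_height_ge (ray Ea u) (ray Eb v).
apply: ge_max3 => //.
apply: (@sdist_ultra _ _ _ (truncate a (clip u))); first exact: cutr.
apply: (@sdist_ultra _ _ _ (truncate b (clip v))) => //.
by rewrite sdistC; exact: cutr.
Qed.

Lemma dist_ray a b (Ea : E a) (Eb : E b) u v : mdist (ray Ea u) (ray Eb v) =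
  2 * Num.max (Num.max (clip u) (clip v)) (sdist a b) - clip u - clip v.
Proof. by rewrite mdistE meet_ray. Qed.

Lemma ray_height x : ray (branch_in x) (height x) = x.
Proof.
apply: tree_eq => /=; rewrite ?clip_id ?height_ge0 ?height_le1 //.
apply/funext => j; rewrite /truncate.
by case: leP => [/branch_cut ->|]; rewrite ?andbT.
Qed.

Lemma ray_continuous a (Ea : E a) : continuous (ray Ea : R -> tree).
Proof.
move=> u; apply/(@metricType_numDomainType.cvgrPdist_lt R tree) => e e0; near=> v.
rewrite dist_ray sdistxx (@le_lt_trans _ _ `|u - v|) //.
  apply: le_trans (clip_dist u v).
  rewrite (max_idPl _); last by rewrite (le_trans (clip_ge0 u)) // le_max lexx.
  have d1 := ler_norm (clip u - clip v).
  have d2 : clip v - clip u <= `|clip u - clip v|.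
    by rewrite distrC ler_norm.
  by case: (leP (clip u) (clip v)) => h; lra.
Unshelve. all: by end_near. Qed.

(** Up from [x] to the meet, then down to [y]; along this path the distance to
[x] increases. *)
Lemma geodesic x y : exists A : set tree, [/\ connected A, A x, A y &
  forall z, A z -> mdist x z <= mdist x y].
Proof.
have [h1 h2 h3] := meet_height_ge x y; set m := meet_height x y in h1 h2 h3.
have m0 : 0 <= m by rewrite (le_trans _ h1) // height_ge0.
have m1 : m <= 1 := meet_height_le1 x y.
pose A := ray (branch_in x) @` `[height x, m].
pose B := ray (branch_in y) @` `[height y, m].
have xm : ray (branch_in x) m = ray (branch_in y) m.
  apply: mdist_positivity; rewrite dist_ray maxxx clip_id //.
  by rewrite (max_idPl h3); lra.
exists (A `|` B); split.
- apply: connectedU.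
  + exists (ray (branch_in x) m); split; first by exists m; rewrite //= in_itv/= lexx h1.
    by exists m; rewrite //= in_itv/= lexx h2.
  + apply: connected_continuous_connected; first exact: segment_connected.
    exact/continuous_subspaceT/ray_continuous.
  + apply: connected_continuous_connected; first exact: segment_connected.
    exact/continuous_subspaceT/ray_continuous.
- by left; exists (height x); rewrite ?ray_height //= in_itv/= lexx h1.
- by right; exists (height y); rewrite ?ray_height //= in_itv/= lexx h2.
have x0 := height_ge0 x; have y0 := height_ge0 y.
have rx v b (Eb : E b) : mdist x (ray Eb v) = 2 * Num.max (Num.max (height x) (clip v))
    (sdist (branch x) b) - height x - clip v.
  by rewrite -[in LHS](ray_height x) dist_ray clip_id ?height_le1.
move=> z; rewrite [mdist x y]mdistE -/m => -[] [v /= /[!in_itv]/= /andP[v1 v2] <-];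
  rewrite rx clip_id; try lra.
  by rewrite sdistxx (max_idPr v1) (max_idPl _); lra.
suff : Num.max (Num.max (height x) v) (sdist (branch x) (branch y)) <= m by lra.
exact: ge_max3.
Qed.

Lemma ball_connected x r : connected (ball x r).
Proof.
have [r0|r0] := leP r 0.
  rewrite (_ : ball x r = set0); first exact: connected0.
  rewrite -subset0 ballEmdist => y /= /lt_le_trans /(_ r0).
  by rewrite ltNge mdist_ge0.
pose A y := sval (cid (geodesic x y)).
rewrite (_ : ball x r = \bigcup_(y in ball x r) A y).
  apply: bigcup_connected => [|y _].
    by exists x => y _; rewrite /A; case: cid => ? /= [].
  by rewrite /A; case: cid => ? /= [].
apply/seteqP; split=> [y xy|z [y]].
  by exists y => //; rewrite /A; case: cid => ? /= [].
rewrite /A ballEmdist /=; case: cid => B /= [_ _ _ h] xy /h; lra.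
Qed.

Lemma dist_le2 x y : mdist x y <= 2.
Proof.
rewrite mdistE; have := height_ge0 x; have := height_ge0 y.
by have := meet_height_le1 x y; lra.
Qed.

Lemma tree_connected (x : tree) : connected [set: tree].
Proof.
suff -> : [set: tree] = ball x 3 by exact: ball_connected.
by apply/esym; rewrite -subTset ballEmdist => y _ /=; have := dist_le2 x y; lra.
Qed.

Lemma tree_locally_connected : locally_connected tree.
Proof.
move=> x U /nbhs_ballP [r /= r0 rU]; exists (ball x r); split=> //.
- rewrite openE => y; rewrite ballEmdist /= => xy; apply/nbhs_ballP.
  exists (r - mdist x y) => [|z]; first by rewrite /= subr_gt0.
  by rewrite !ballEmdist /=; have := metric_triangle x y z; lra.
- exact: ballxx.
- exact: ball_connected.
Qed.

Lemma near_agree (a : cantor_space) N :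
  \forall b \near a, forall j, (j < N)%N -> b j = a j.
Proof.
elim: N => [|N IH]; first by near=> b => j; rewrite ltn0.
have h : \forall b \near a, b N = a N.
  have /= := @proj_continuous nat (fun=> bool) N a.
  move=> /(_ [set a N]); apply; apply: open_nbhs_nbhs.
  by split=> //; exact: discrete_open.
near=> b => j; rewrite ltnS leq_eqVlt => /orP[/eqP->|].
  by near: b.
move: j; near: b; exact: IH.
Unshelve. all: by end_near. Qed.

(** Every point is [ray a u] for some end [a] and [u] in [0, 1], and [ray] depends
continuously on both. *)
Lemma tree_compact : closed (E : set cantor_space) -> compact [set: tree].
Proof.
move=> Ecl.
have [[x0 _]|none] := pselect (exists x : tree, True); last first.
  rewrite (_ : setT = set0); first exact: compact0.
  by rewrite -subset0 => x _; apply: none; exists x.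
pose g (p : cantor_space * R) : tree :=
  if pselect (E p.1) is left Ea then ray Ea p.2 else x0.
pose K : set (cantor_space * R) := (E : set cantor_space) `*` `[0, 1].
have cK : compact K.
  apply: compact_setX; last exact: segment_compact.
  by apply: (@subclosed_compact _ _ setT) => //; exact: cantor_space_compact.
have -> : [set: tree] = g @` K.
  apply/esym; rewrite -subTset => x _.
  exists (branch x, height x).
    by split; [exact: branch_in|rewrite /= in_itv/= height_ge0 height_le1].
  rewrite /g /=; case: pselect => [Ea|/(_ (branch_in x))//].
  by rewrite (Prop_irrelevance Ea (branch_in x)) ray_height.
apply: continuous_compact cK; apply/subspace_continuousP => -[a u] [/= Ea _].
apply/(@metricType_numDomainType.cvgrPdist_lt R tree) => e e0.
have [N hN] := @wt_small R (e / 4) ltac:(lra).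
have H : filter_prod (nbhs a) (nbhs u)
    (fun p => (forall j, (j < N)%N -> p.1 j = a j) /\ `|u - p.2| < e / 4).
  exists ([set b | forall j, (j < N)%N -> b j = a j], ball u (e / 4)) => /=.
    by split; [exact: near_agree|apply: nbhsx_ballx; lra].
  by move=> p [].
apply: filterS H => -[b v] /= [ba uv] [/= Eb _].
rewrite /from_subspace /g /=; case: pselect => [Ea'|/(_ Ea)//].
case: pselect => [Eb'|/(_ Eb)//].
rewrite dist_ray.
have hr : sdist a b <= e / 4.
  apply: sdist_le => [|j aj]; first lra.
  by have [/ba/esym //|/hN /ltW //] := ltnP j N.
have d1 := ler_norm (clip u - clip v).
have d2 : clip v - clip u <= `|clip u - clip v| by rewrite distrC ler_norm.
have d3 := clip_dist u v; have := clip_ge0 u; have := clip_ge0 v => v0 u0.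
suff : Num.max (Num.max (clip u) (clip v)) (sdist a b)
    <= (clip u + clip v) / 2 + e * 3 / 8 by lra.
by apply: ge_max3; lra.
Qed.

End tree.

(** * Cut points exclude circles *)

Section no_circle.
Variables (R : realType).

(** A circle without one point is a line: [h] is the inverse of the stereographic
projection from (a, b), whose parameter is the cotangent of half the angle
between (a, b) and the point. *)
Lemma circle_minus_point (a b : R) : a ^+ 2 + b ^+ 2 = 1 ->
  exists h : R -> R * R, [/\ continuous h,
    forall t, unit_circle (h t),
    forall t, h t <> (a, b) &
    forall p, unit_circle p -> p <> (a, b) -> exists t, h t = p].
Proof.
move=> ab1; pose h (t : R) : R * R :=
  (((t ^+ 2 - 1) * a - 2 * t * b) / (t ^+ 2 + 1),
   ((t ^+ 2 - 1) * b + 2 * t * a) / (t ^+ 2 + 1)).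
have den0 (t : R) : t ^+ 2 + 1 != 0.
  by rewrite gt_eqF // ltr_wpDl // sqr_ge0.
exists h; split.
- move=> t; apply: (@cvg_pair _ _ _ (nbhs t) (nbhs (h t).1) (nbhs (h t).2)) => /=.
  + apply: cvgM; last first.
      apply: cvgV => //; apply: cvgD; last exact: cvg_cst.
      exact: exprn_continuous.
    apply: cvgB; apply: cvgM; try exact: cvg_cst.
      by apply: cvgB; [exact: exprn_continuous|exact: cvg_cst].
    by apply: cvgM; [exact: cvg_cst|exact: cvg_id].
  + apply: cvgM; last first.
      apply: cvgV => //; apply: cvgD; last exact: cvg_cst.
      exact: exprn_continuous.
    apply: cvgD; apply: cvgM; try exact: cvg_cst.
      by apply: cvgB; [exact: exprn_continuous|exact: cvg_cst].
    by apply: cvgM; [exact: cvg_cst|exact: cvg_id].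
- move=> t; rewrite /unit_circle /h /=.
  apply: (mulIf (expf_neq0 2 (den0 t))); rewrite mulrDl !exprMn !exprVn.
  rewrite !(mulfVK (expf_neq0 2 (den0 t))) mul1r.
  rewrite [RHS](_ : _ = (t ^+ 2 + 1) ^+ 2 * (a ^+ 2 + b ^+ 2)); last by rewrite ab1 mulr1.
  ring.
- move=> t [/(canRL (mulfVK (den0 t))) e1 /(canRL (mulfVK (den0 t))) e2].
  have : (t ^+ 2 + 1) * (a ^+ 2 + b ^+ 2) = (t ^+ 2 - 1) * (a ^+ 2 + b ^+ 2).
    rewrite !mulrDr.
    have -> : (t ^+ 2 + 1) * a ^+ 2 = a * (a * (t ^+ 2 + 1)) by ring.
    have -> : (t ^+ 2 + 1) * b ^+ 2 = b * (b * (t ^+ 2 + 1)) by ring.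
    by rewrite -e1 -e2; ring.
  by rewrite ab1; lra.
- move=> [x y] /=; rewrite /unit_circle /= => xy1 nab.
  (* c and s are the cosine and the sine of the angle from (a, b) to (x, y) *)
  pose c := x * a + y * b; pose s := y * a - x * b.
  have cs : c ^+ 2 + s ^+ 2 = 1.
    by rewrite -[RHS](mulr1 1) -{1}ab1 -xy1 /c /s; ring.
  have xE : x = c * a - s * b.
    by rewrite -[LHS]mulr1 -ab1 /c /s; ring.
  have yE : y = c * b + s * a.
    by rewrite -[LHS]mulr1 -ab1 /c /s; ring.
  have c1 : 1 - c != 0.
    rewrite subr_eq0; apply/eqP => c1; apply: nab.
    have s0 : s = 0.
      apply/eqP; rewrite -sqrf_eq0; move: cs; rewrite -c1 expr1n => ?.
      by apply/eqP; lra.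
    by rewrite xE yE -c1 s0; congr pair; ring.
  exists (s / (1 - c)).
  have e1 : (s / (1 - c)) ^+ 2 + 1 = 2 / (1 - c).
    have -> : (s / (1 - c)) ^+ 2 = (1 - c ^+ 2) / (1 - c) ^+ 2.
      by rewrite -cs expr_div_n; congr (_ / _); ring.
    by field.
  have e2 : (s / (1 - c)) ^+ 2 - 1 = 2 * c / (1 - c).
    by apply: (addIr 2); transitivity ((s / (1 - c)) ^+ 2 + 1); [ring|rewrite e1; field].
  by rewrite /h e1 e2 xE yE; congr pair; field.
Qed.

(** On a circle a continuous function takes an intermediate value [s] at least
twice: once by the intermediate value theorem, and once more on the line that
remains when the first such point is removed. *)
Lemma no_circle_of_cuts (X : topologicalType) :
  (forall p q : X, p <> q -> exists (phi : X -> R) (s : R),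
     [/\ continuous phi, (phi p < s < phi q) \/ (phi q < s < phi p) &
         forall x y, phi x = s -> phi y = s -> x = y]) ->
  ~ exists C : set X, homeomorphic_sets (@unit_circle R) C.
Proof.
move=> cuts [C [f [g [[fc _] [fC _] gf _]]]].
have u1 : unit_circle ((1, 0) : R * R) by rewrite /unit_circle /= expr1n expr0n /= addr0.
have u2 : unit_circle ((-1, 0) : R * R) by rewrite /unit_circle /= sqrrN expr1n expr0n /= addr0.
have f12 : f (1, 0) <> f (-1, 0).
  by move=> /(congr1 g); rewrite !gf // => -[]; lra.
have [phi [s [phic phis uniq]]] := cuts _ _ f12.
(* the intermediate value theorem on the circle without (a, b) *)
have level a b : unit_circle ((a, b) : R * R) -> (1, 0) <> (a, b) -> (-1, 0) <> (a, b) ->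
    exists2 z : R * R, unit_circle z /\ z <> (a, b) & phi (f z) = s.
  move=> uab n1 n2.
  have [h [hc hu hn hs]] := circle_minus_point uab.
  have [t1 ht1] := hs _ u1 n1; have [t2 ht2] := hs _ u2 n2.
  have cF : continuous (phi \o (f \o h)).
    move=> t; apply: continuous_comp; last exact: phic.
    have /subspace_continuousP /(_ (h t) (hu t)) fch := fc.
    apply: cvg_comp fch => U hU.
    apply: (@filterS _ (nbhs t) _ [set t' | unit_circle (h t') -> U (h t')]
      (h @^-1` U)) => [t'|]; [by apply; exact: hu|exact: hc t _ hU].
  have [t ht] : exists t, phi (f (h t)) = s.
    pose a0 := Num.min t1 t2; pose b0 := Num.max t1 t2.
    have ab0 : a0 <= b0 by rewrite /a0 /b0 ge_min !le_max lexx.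
    have [|c _ cs] := @IVT R (phi \o (f \o h)) a0 b0 s ab0 (continuous_subspaceT cF).
      rewrite /a0 /b0 /= ge_min le_max; case: (leP t1 t2) => _; rewrite ht1 ht2;
      by case: phis => /andP[/ltW -> /ltW ->]; rewrite ?orbT.
    by exists c.
  by exists (h t).
have [[a b] [uz nz] ez] := @level 0 1 ltac:(by rewrite /unit_circle /= expr0n expr1n add0r)
  ltac:(by case; lra) ltac:(by case; lra).
have [z' [uz' nz'] ez'] : exists2 z : R * R, unit_circle z /\ z <> (a, b) & phi (f z) = s.
  apply: level => // eab; move: ez; rewrite -eab => ez;
    by case: phis; rewrite ez ltxx ?andbF.
by apply: nz'; rewrite -[LHS]gf // -[RHS]gf //; congr g; exact: uniq.
Qed.
End no_circle.

(** * The tree is a dendrite *)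

Section tree_no_circle.
Variables (R : realType) (E : set (nat -> bool)).
Hypothesis E_hereditary :
  forall a b : nat -> bool, E a -> (forall j, b j -> a j) -> E b.
Local Notation tree := (@tree R E).

(** The height of the meet of [x] with the end [a]. Along the ray to [a] it is the
height itself, and it is constant on every subtree that hangs off that ray. *)
Definition meet_end (a : nat -> bool) (x : tree) : R :=
  Num.max (height x) (sdist (branch x) a).

Lemma meet_end_continuous a : continuous (meet_end a).
Proof.
move=> x; apply/(@cvgrPdist_lt _ R^o _ (nbhs x)) => e e0.
apply/nbhs_ballP; exists e => // y; rewrite ballEmdist /= mdistE => xy.
have [h1 h2 h3] := meet_height_ge x y.
have bd (u v : tree) : height u <= meet_height u v -> height v <= meet_height u v ->
    sdist (branch v) (branch u) <= meet_height u v ->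
    meet_end a v <= meet_end a u \/ meet_end a v <= meet_height u v.
  move=> p1 p2 p3; apply/orP; rewrite -le_max {1}/meet_end ge_max; apply/andP; split.
    by rewrite le_max p2 orbT.
  apply: (@sdist_ultra _ _ _ (branch u)); first by rewrite le_max p3 orbT.
  by rewrite /meet_end !le_max lexx orbT.
have b1 := bd x y h1 h2 ltac:(by rewrite sdistC).
have b2 := bd y x ltac:(by rewrite meet_heightC) ltac:(by rewrite meet_heightC)
  ltac:(by rewrite meet_heightC).
have e1 : height x <= meet_end a x by rewrite le_max lexx.
have e2 : height y <= meet_end a y by rewrite le_max lexx.
rewrite ltr_norml; rewrite (meet_heightC y x) in b2.
by apply/andP; split; case: b1 => b1; case: b2 => b2; lra.
Qed.

(** Subtrees hang off the ray to [a] at weights only, so any other level is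
attained on the ray alone, once. *)
Lemma meet_end_level a (Ea : E a) s (x : tree) :
  (forall j, s <> wt j) -> 0 < s -> meet_end a x = s -> x = ray E_hereditary Ea s.
Proof.
move=> sw s0; rewrite /meet_end => xs.
have hr : sdist (branch x) a < s.
  have : sdist (branch x) a <= s by rewrite -xs le_max lexx orbT.
  rewrite le_eqVlt => /orP[/eqP rs|//]; case: (@sdist_val R (branch x) a) => [|[j]].
    by rewrite rs => s00; move: s0; rewrite s00 ltxx.
  by rewrite rs => /sw.
have hx : height x = s by move: xs; case: leP => // _ rs; rewrite rs ltxx in hr.
rewrite -[LHS](ray_height E_hereditary); apply: mdist_positivity; rewrite dist_ray hx.
by rewrite maxxx (max_idPl _); [lra|rewrite clip_id ?(ltW s0) ?(ltW hr) // -hx height_le1].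
Qed.

Lemma tree_no_circle :
  ~ exists C : set tree, homeomorphic_sets (@unit_circle R) C.
Proof.
apply: no_circle_of_cuts => p q pq.
(* the path from x to y starts upwards, and a level on its rising part separates them *)
have wlog_cut (x y : tree) : height x < meet_height x y ->
    exists (phi : tree -> R) s, [/\ continuous phi, phi x < s < phi y &
         forall x y, phi x = s -> phi y = s -> x = y].
  move=> xm; have [s [us sm nw]] := nonweight_between (height_ge0 x) xm.
  have s0 : 0 < s by apply: le_lt_trans us; exact: height_ge0.
  exists (meet_end (branch x)), s; split; first exact: meet_end_continuous.
    rewrite {1}/meet_end sdistxx (max_idPl (height_ge0 x)) us /=.
    apply: lt_le_trans sm _; rewrite leNgt; apply/negP => ym.
    have : meet_height x y <= Num.max (height x) (meet_end (branch x) y).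
      rewrite /meet_end sdistC; apply: meet_height_le; rewrite !le_max lexx ?orbT //.
    by rewrite leNgt gt_max xm ym.
  by move=> z t /(meet_end_level (branch_in x) nw s0) -> /(meet_end_level (branch_in x) nw s0) ->.
have [hp|hp] := ltP (height p) (meet_height p q).
  by have [phi [s [c1 c2 c3]]] := wlog_cut p q hp; exists phi, s; split => //; left.
have [hq|hq] := ltP (height q) (meet_height q p).
  by have [phi [s [c1 c2 c3]]] := wlog_cut q p hq; exists phi, s; split => //; right.
exfalso; apply: pq; apply: mdist_positivity; rewrite mdistE.
have [h1 h2 _] := meet_height_ge p q; rewrite (meet_heightC q p) in hq; lra.
Qed.

Lemma tree_dendrite (x : tree) : closed (E : set cantor_space) -> dendrite tree.
Proof.
move=> Ecl; split.
- split; [by exists x|exact: tree_compact|exact: tree_connected].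
- exact: tree_locally_connected.
- exact: tree_no_circle.
Qed.

End tree_no_circle.

(** * Sequences with periodic windows of zeros *)

Section windows.
Local Open Scope nat_scope.

(** Powers of 2 and of 3 in turn make consecutive periods coprime; the exponent
makes the windows of length [m] rare ([period_large]). *)
Definition period m := (odd m + 2) ^ (2 * m).+2.

Lemma period_gt0 m : 0 < period m.
Proof. by rewrite expn_gt0 addn_gt0 orbT. Qed.

Lemma coprime_period m : coprime (period m) (period m.+1).
Proof. by rewrite /period coprimeXl // coprimeXr //=; case: (odd m). Qed.

Lemma period_large m : m * 2 ^ m.+2 <= period m.
Proof.
apply: (@leq_trans (2 ^ (2 * m).+2)); last by rewrite leq_exp2r //; case: (odd m).
rewrite (_ : (2 * m).+2 = m + m.+2); last by lia.
by rewrite expnD leq_mul2r (ltnW (ltn_expl m _)) ?orbT.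
Qed.

Lemma leq_period m : m.*2 <= period m.
Proof.
apply: leq_trans (period_large m); rewrite -muln2 leq_mul2l.
by rewrite -{1}(expn1 2) leq_exp2l ?orbT.
Qed.

Definition windowed : set (nat -> bool) :=
  [set a | forall m, exists c, forall k, k = c %[mod period m] ->
    forall i, i < m -> a (k + i) = false].

Lemma windowed_hereditary (a b : nat -> bool) :
  windowed a -> (forall j, b j -> a j) -> windowed b.
Proof.
move=> wa ba m; have [c hc] := wa m; exists c => k kc i im.
by apply: contraFF (hc k kc i im); exact: ba.
Qed.

Lemma windowed0 : windowed (fun=> false).
Proof. by move=> m; exists 0. Qed.

Lemma windowed_shift a : windowed a -> windowed (fun j => a j.+1).
Proof.
move=> wa m; have [c hc] := wa m; have p0 := period_gt0 m.
exists (c + (period m).-1) => k kc i im; rewrite -addSn; apply: hc => //.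
have -> : c = c + period m %[mod period m] by rewrite modnDr.
have -> : c + period m = (c + (period m).-1) + 1 by lia.
by rewrite -addn1; apply/eqP; rewrite eqn_modDr; apply/eqP.
Qed.

(** The windows of [a] of length [m] and those of [b] of length [m.+1] recur with
coprime periods, so they start together along a residue class. *)
Lemma windowed_common a b m : windowed a -> windowed b ->
  exists P c, 0 < P /\ forall k, k = c %[mod P] ->
    forall i, i < m -> a (k + i) = b (k + i).
Proof.
move=> /(_ m) [c hc] /(_ m.+1) [d hd]; have cop := coprime_period m.
exists (period m * period m.+1), (chinese (period m) (period m.+1) c d).
split=> [|k kc i im]; first by rewrite muln_gt0 !period_gt0.
have ka : k = c %[mod period m].
  rewrite -[in RHS](chinese_modl cop c d).
  rewrite -(modn_dvdm k (dvdn_mulr (period m.+1) (dvdnn (period m)))).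
  by rewrite kc (modn_dvdm _ (dvdn_mulr _ (dvdnn _))).
have kb : k = d %[mod period m.+1].
  rewrite -[in RHS](chinese_modr cop c d).
  rewrite -(modn_dvdm k (dvdn_mull (period m) (dvdnn (period m.+1)))).
  by rewrite kc (modn_dvdm _ (dvdn_mull _ (dvdnn _))).
by rewrite (hc k ka i im) (hd k kb i (leqW im)).
Qed.

Lemma count_geq a n : count (leq a) (iota 0 n) = n - a.
Proof.
elim: n => [//|n IH]; rewrite -addn1 iotaD count_cat IH /= add0n addn0.
by case: leqP => ? /=; lia.
Qed.

(** The residues counted come at the end of each period, so an incomplete period
contains at most its share of them and no error term is needed. *)
Lemma count_residue p m n : 0 < p -> m <= p ->
  count (fun k => p - m <= k %% p) (iota 0 n) * p <= n * m.
Proof.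
move=> p0 mp; elim/ltn_ind: n => n IH; have [np|pn] := leqP n p.
  have -> : count (fun k => p - m <= k %% p) (iota 0 n) = n - (p - m).
    rewrite -(count_geq (p - m) n); apply: eq_in_count => k; rewrite mem_iota add0n => /andP[_ kn].
    by rewrite modn_small // (leq_trans kn).
  have [h|/ltnW h] := leqP n (p - m); first by rewrite (eqP h).
  have : (p - n) * (p - m) >= 0 by [].
  by nia.
have -> : n = p + (n - p) by lia.
rewrite iotaD count_cat add0n mulnDl mulnDl; apply: leq_add.
  rewrite (@eq_in_count _ _ (leq (p - m))) ?count_geq; first by nia.
  by move=> k; rewrite mem_iota add0n => /andP[_ kp]; rewrite modn_small.
rewrite -[X in iota X _]addn0 iotaDl count_map.
rewrite (eq_count (a2 := fun k => p - m <= k %% p)) => [|k /=]; first by apply: IH; lia.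
by rewrite modnDl.
Qed.

(** A union bound with densities 2^-(m+2), written without division. *)
Lemma count_union (Q : nat -> pred nat) n M :
  (forall m, count (Q m) (iota 0 n) * 2 ^ m.+2 <= n) ->
  count (fun k => has (Q ^~ k) (iota 0 M)) (iota 0 n) * 2 ^ M.+1 <= n * (2 ^ M - 1).
Proof.
move=> hQ; elim: M => [|M IH]; first by rewrite count_pred0.
have h : count (fun k => has (Q ^~ k) (iota 0 M.+1)) (iota 0 n) <=
    count (fun k => has (Q ^~ k) (iota 0 M)) (iota 0 n) + count (Q M) (iota 0 n).
  rewrite -count_predUI; apply: leq_trans (leq_addr _ _); apply: sub_count => k.
  by rewrite -addn1 iotaD has_cat /= orbF.
apply: leq_trans (leq_mul h (leqnn _)) _; rewrite mulnDl.
have e1 := expn_gt0 2 M; have := hQ M; rewrite /= in e1.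
move: IH; rewrite !(expnS 2 M.+1) !(expnS 2 M); nia.
Qed.

(** The times at which a one is allowed: those outside the windows of length [m]
that end just before the multiples of [period m]. Larger [m] put no condition
on [k] because the first such window starts after [k]. *)
Definition admissible k := all (fun m => k %% period m < period m - m) (iota 0 k.+1).

Lemma admissibleP k m : admissible k -> k %% period m < period m - m.
Proof.
move=> /allP fk; have [mk|km] := leqP m k; first by apply: fk; rewrite mem_iota /= add0n ltnS.
by apply: leq_ltn_trans (leq_mod _ _) _; have := leq_period m; lia.
Qed.

Lemma count_admissible n : n <= 2 * count admissible (iota 0 n).
Proof.
pose Q m k := period m - m <= k %% period m.
have hQ m : count (Q m) (iota 0 n) * 2 ^ m.+2 <= n.
  have mp : m <= period m by have := leq_period m; lia.
  have := count_residue n (period_gt0 m) mp; rewrite -/(Q m); case: m {mp} => [|m].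
    by rewrite muln0 leqn0 muln_eq0 => /orP[/eqP ->//|/eqP h]; have := period_gt0 0; rewrite h.
  have := period_large m.+1 => h1 h2.
  rewrite -(@leq_pmul2r m.+1) // -mulnA (leq_trans _ h2) // leq_mul2l.
  by rewrite (mulnC _ m.+1) h1 orbT.
have := @count_union Q n n hQ.
have <- : count (predC admissible) (iota 0 n) = count (fun k => has (Q ^~ k) (iota 0 n)) (iota 0 n).
  apply: eq_in_count => k; rewrite mem_iota add0n /= => kn.
  rewrite /admissible -has_predC; apply/hasP/hasP => -[m].
    rewrite !mem_iota /= !add0n => mk; rewrite -leqNgt => Qm; exists m => //.
    by rewrite mem_iota /= add0n; lia.
  move=> _ Qm; exists m; last by rewrite /= -leqNgt.
  rewrite mem_iota /= add0n ltnNge; apply/negP => km.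
  have := leq_trans Qm (leq_mod _ _); have := leq_period m; lia.
have := count_predC admissible (iota 0 n); rewrite size_iota => eqn.
have := expn_gt0 2 n; rewrite expnS /=; nia.
Qed.

Lemma block_ex k : exists m, k < m.+1`!.
Proof. by exists k; apply: leq_trans (fact_geq _). Qed.

Definition block k := ex_minn (block_ex k).

Lemma blockE m k : m`! <= k -> k < m.+1`! -> block k = m.
Proof.
move=> mk km; rewrite /block; case: ex_minnP => b kb bmin.
have := bmin m km; rewrite leq_eqVlt => /orP[/eqP//|bm].
by have := leq_trans kb (leq_trans (leq_fact bm) mk); rewrite ltnn.
Qed.

(** Any function that takes every value infinitely often would do. *)
Definition selector m := logn 2 m.

Lemma selector_inf i N : exists2 m, N <= m & selector m = i.
Proof.
exists (2 ^ i * (2 * N).+1).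
  by have := expn_gt0 2 i; rewrite /=; nia.
rewrite /selector lognM ?expn_gt0 // pfactorK // logn_coprime ?addn0 //.
by rewrite coprime2n /= mul2n odd_double.
Qed.

Definition coded (c : nat -> bool) k := admissible k && c (selector (block k)).

Lemma coded_windowed c : windowed (coded c).
Proof.
move=> m; exists (period m - m) => k kp i im; apply/negP => /andP[/(@admissibleP _ m)].
have pm := leq_period m; have p0 := period_gt0 m.
rewrite -modnDml kp modnDml modn_small; lia.
Qed.

(** If block [m] carries the bit [i], the sequences differ at all the admissible
times of the block: at least half of [m.+1`!] up to the [m`!] earlier times. *)
Lemma count_far_coded c d i : c i <> d i -> forall N, exists2 n, N <= n &
  n < 4 * count (fun k => coded c k != coded d k) (iota 0 n.+1).
Proof.
move=> cd N; have [m Nm mi] := selector_inf i (N + 3).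
have f0 := fact_gt0 m; have fS := factS m.
exists m.+1`!.-1; first by rewrite fS; nia.
rewrite prednK ?fact_gt0 //.
have h1 := count_admissible m.+1`!.
have sz : count (fun k => admissible k && (k < m`!)) (iota 0 m.+1`!) <= m`!.
  apply: leq_trans (sub_count (a2 := predC (leq m`!)) _ _) _ => [k /andP[_]|].
    by rewrite /= -ltnNge.
  have := count_predC (leq m`!) (iota 0 m.+1`!); rewrite count_geq size_iota; nia.
have : count admissible (iota 0 m.+1`!) <=
    count (fun k => admissible k && (k < m`!)) (iota 0 m.+1`!) +
    count (fun k => coded c k != coded d k) (iota 0 m.+1`!).
  rewrite -count_predUI; apply: leq_trans (leq_addr _ _).
  rewrite -(@eq_in_count _ (predI admissible predT)) => [|k]; last by rewrite /= andbT.
  apply: (@leq_trans (count (fun k => admissible k &&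
      ((k < m`!) || (coded c k != coded d k))) (iota 0 m.+1`!))).
    rewrite leq_eqVlt; apply/orP; left; apply/eqP; apply: eq_in_count => k.
    rewrite mem_iota add0n /= andbT => km; case fk: (admissible k) => //=.
    have [//|mk] := ltnP k m`!; rewrite /coded fk (blockE mk km) mi /=.
    by apply/esym/eqP => e; apply: cd.
  by apply: sub_count => k /= /andP[-> /orP[->|->]]; rewrite ?orbT.
nia.
Qed.

(** If block [m] carries the bit 0, both sequences vanish on it, so a window of
length [L] shows a difference only if it starts before [m`!] or in the last
[L] times of the block. *)
Lemma count_close_coded c d : c 0 = false -> d 0 = false ->
  forall q L N, exists2 n, N <= n &
    q * count (fun k => [exists i : 'I_L, coded c (k + i) != coded d (k + i)]) (iota 0 n.+1) <= n.
Proof.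
move=> c0 d0 q L N; have [m Nm m0] := selector_inf 0 (N + q * L.+1 + 1).
have f0 := fact_gt0 m; have fS := factS m.
exists m.+1`!.-1; first by rewrite fS; nia.
rewrite prednK ?fact_gt0 //.
have off k : m`! <= k -> k < m.+1`! -> coded c k = coded d k.
  by move=> mk km; rewrite /coded (blockE mk km) m0 c0 d0.
suff : count (fun k => [exists i : 'I_L, coded c (k + i) != coded d (k + i)])
   (iota 0 m.+1`!) <= m`! + L by rewrite fS; nia.
apply: (@leq_trans (count (predC (leq m`!)) (iota 0 m.+1`!) +
    count (leq (m.+1`! - L)) (iota 0 m.+1`!))).
  rewrite -count_predUI; apply: leq_trans (leq_addr _ _).
  apply: sub_count => k /existsP [[i iL]] /=.
  case: (leqP m`! k) => //= mk; case: leqP => // km /eqP []; apply: off; lia.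
have := count_predC (leq m`!) (iota 0 m.+1`!); rewrite !count_geq size_iota; lia.
Qed.

End windows.

(** * Frequencies of close times *)

Section frequencies.
Variables (R : realType) (X : metricType R) (f : X -> X).
Implicit Types (x y : X) (u : R^nat).

Lemma le_limn_inf u c : bounded_fun u -> (exists N, forall n, (N <= n)%N -> c <= u n) ->
  c <= limn_inf u.
Proof.
move=> bu [N hN]; rewrite limn_infE //.
apply: (@le_trans _ _ (infs u N)).
  apply: lb_le_inf => [|_ [n /= Nn <-]]; last exact: hN.
  by exists (u N); exists N => /=.
by apply: ub_le_sup; [exact: bounded_fun_has_ubound_infs|exists N].
Qed.

Lemma limn_inf_le u c : bounded_fun u -> (forall N, exists2 n, (N <= n)%N & u n <= c) ->
  limn_inf u <= c.
Proof.
move=> bu hu; rewrite limn_infE //; apply: ge_sup => [|_ [N _ <-]].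
  by exists (infs u 0); exists 0%N.
have [n Nn uc] := hu N; apply: le_trans uc; apply: ge_inf; last by exists n.
exact/has_lbound_sdrop/bounded_fun_has_lbound.
Qed.

Lemma limn_sup_le u c : bounded_fun u -> (exists N, forall n, (N <= n)%N -> u n <= c) ->
  limn_sup u <= c.
Proof.
move=> bu [N hN]; rewrite limn_supE //.
apply: (@le_trans _ _ (sups u N)).
  by apply: ge_inf; [exact: bounded_fun_has_lbound_sups|exists N].
apply: ge_sup => [|_ [n /= Nn <-]]; last exact: hN.
by exists (u N); exists N => /=.
Qed.

Lemma le_limn_sup u c : bounded_fun u -> (forall N, exists2 n, (N <= n)%N & c <= u n) ->
  c <= limn_sup u.
Proof.
move=> bu hu; rewrite limn_supE //; apply: lb_le_inf => [|_ [N _ <-]].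
  by exists (sups u 0); exists 0%N.
have [n Nn uc] := hu N; apply: le_trans uc _; apply: ub_le_sup; last by exists n.
exact/has_ubound_sdrop/bounded_fun_has_ubound.
Qed.

Definition close_at x y (d : R) : pred nat :=
  fun k => mdist (iter k f x) (iter k f y) < d.

Lemma close_freqE x y d n :
  close_freq f x y d n = n%:R^-1 * (count (close_at x y d) (iota 0 n.+1))%:R.
Proof.
rewrite /close_freq cardE size_filter -enumT -val_enum_ord count_map.
by congr (_ * _%:R).
Qed.

Lemma close_freq_ge0 x y d n : 0 <= close_freq f x y d n.
Proof. by rewrite mulr_ge0 ?invr_ge0. Qed.

Lemma close_freq_bounds x y d n q : (0 < n)%N ->
  ((count (close_at x y d) (iota 0 n.+1))%:R <= q * n%:R -> close_freq f x y d n <= q) /\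
  (q * n%:R <= (count (close_at x y d) (iota 0 n.+1))%:R -> q <= close_freq f x y d n).
Proof.
move=> n0; have n0' : 0 < n%:R :> R by rewrite ltr0n.
by rewrite close_freqE (mulrC q) ler_pdivrMl // ler_pdivlMl.
Qed.

Lemma close_freq_bounded x y d : bounded_fun (close_freq f x y d).
Proof.
exists 2; split; first exact: num_real.
move=> r r2 n _; rewrite /= ger0_norm ?close_freq_ge0 //; apply: le_trans (ltW r2).
case: n => [|n]; first by rewrite /close_freq invr0 mul0r.
apply: (close_freq_bounds x y d 2 (ltn0Sn n)).1.
rewrite -natrM ler_nat (leq_trans (count_size _ _)) // size_iota; lia.
Qed.

(** A residue class modulo [P] has density 1/P; half of it absorbs the first [K]
times. *)
Lemma Phi_inf_gt0 x y d P c K : (0 < P)%N ->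
  (forall k, (K <= k)%N -> k = c %[mod P] -> close_at x y d k) ->
  0 < Phi_inf f x y d.
Proof.
move=> P0 hc; have P0' : 0 < P%:R :> R by rewrite ltr0n.
apply: (@lt_le_trans _ _ (P%:R^-1 / 2)); first by rewrite divr_gt0 ?invr_gt0.
apply: le_limn_inf; first exact: close_freq_bounded.
pose K' := (K * P + c)%N.
exists (2 * K').+1 => n Kn; have n0 : (0 < n)%N by lia.
apply: (close_freq_bounds x y d _ n0).2.
rewrite -invfM ler_pdivrMl ?mulr_gt0 // -!natrM ler_nat.
have h : ((n - K') %/ P < count (close_at x y d) (iota 0 n.+1))%N.
  rewrite -(size_iota 0 ((n - K') %/ P).+1) -(size_map (fun i => K' + i * P)%N) -size_filter.
  apply: uniq_leq_size.
    rewrite map_inj_uniq ?iota_uniq // => i j /addnI /eqP.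
    by rewrite eqn_pmul2r // => /eqP.
  move=> _ /mapP [i + ->]; rewrite mem_iota add0n ltnS => /andP[_ iK].
  have iP : (i * P <= n - K')%N by apply: leq_trans (leq_divM _ P); rewrite leq_mul2r iK orbT.
  rewrite mem_filter mem_iota add0n; apply/andP; split; last by lia.
  apply: hc; first by rewrite /K'; nia.
  by rewrite /K' addnAC -mulnDl modnMDl.
have := ltn_ceil (n - K') P0; nia.
Qed.

(** The limit is in fact 0; any bound below 1 rules out a DC1 pair. *)
Lemma Phi_sup_far x y d K : (forall k, (K <= k)%N -> ~~ close_at x y d k) ->
  Phi_sup f x y d <= 2^-1.
Proof.
move=> far; apply: limn_sup_le; first exact: close_freq_bounded.
exists (2 * K).+1 => n Kn; have n0 : (0 < n)%N by lia.
apply: (close_freq_bounds x y d _ n0).1.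
rewrite ler_pdivlMl // -natrM ler_nat.
have : (count (close_at x y d) (iota 0 n.+1) <= K)%N; last by lia.
have -> : n.+1 = (K + (n.+1 - K))%N by lia.
rewrite iotaD count_cat add0n addnC (_ : count _ (iota K _) = 0%N) ?add0n.
  by rewrite (leq_trans (count_size _ _)) ?size_iota.
apply/eqP; rewrite -leqn0 leqNgt -has_count; apply/hasPn => k.
by rewrite mem_iota => /andP[/far].
Qed.

Lemma Phi_sup_eq1 x y d :
  (forall q N, exists2 n, (N <= n)%N &
     (q * count (predC (close_at x y d)) (iota 0 n.+1) <= n)%N) ->
  Phi_sup f x y d = 1.
Proof.
move=> h; apply/eqP; rewrite eq_le; apply/andP; split; apply/ler_addgt0Pr => e e0.
  apply: limn_sup_le; first exact: close_freq_bounded.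
  have [N hN] : exists N, forall n, (N <= n)%N -> 1 <= e * n%:R.
    exists (Num.truncn e^-1).+1 => n hn; rewrite -ler_pdivrMl // mulr1.
    apply: le_trans (_ : (Num.truncn e^-1).+1%:R <= _); last by rewrite ler_nat.
    exact/ltW/truncnS_gt.
  exists N.+1 => n Nn; have n0 : (0 < n)%N by lia.
  apply: (close_freq_bounds x y d _ n0).1; rewrite mulrDl mul1r.
  apply: (@le_trans _ _ (n.+1)%:R).
    by rewrite ler_nat (leq_trans (count_size _ _)) ?size_iota.
  by rewrite -natr1 lerD2l hN // ltnW.
rewrite -lerBlDr; apply: le_limn_sup; first exact: close_freq_bounded.
move=> N; pose q := (Num.truncn e^-1).+1.
have [n Nn hq] := h q N.+1; exists n; first exact: ltnW.
have n0 : (0 < n)%N by lia.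
apply: (close_freq_bounds x y d _ n0).2.
have := count_predC (close_at x y d) (iota 0 n.+1); rewrite size_iota.
set a := count _ _; set b := count _ _ => ab.
have eq1 : 1 <= e * q%:R.
  by rewrite -ler_pdivrMl // mulr1; exact/ltW/truncnS_gt.
have q0 : 0 < q%:R :> R by rewrite ltr0n.
have hq' : q%:R * b%:R <= n%:R :> R by rewrite -natrM ler_nat.
have ab' : a%:R + b%:R = n%:R + 1 :> R by rewrite -natrD natr1 ab.
have bn : b%:R <= e * n%:R.
  rewrite -(ler_pM2l q0) (le_trans hq') // mulrA (mulrC _ e).
  by rewrite ler_peMl.
lra.
Qed.

(** The frequency is infinitely often at most 3/4 + 1/n, and [n] can be taken at
least 8. *)
Lemma Phi_inf_lt1 x y d :
  (forall N, exists2 n, (N <= n)%N &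
     (n < 4 * count (predC (close_at x y d)) (iota 0 n.+1))%N) ->
  Phi_inf f x y d < 1.
Proof.
move=> h; apply: (@le_lt_trans _ _ (7 / 8)); last by lra.
apply: limn_inf_le; first exact: close_freq_bounded.
move=> N; have [n Nn hn] := h (N + 8)%N; exists n; first by lia.
have n0 : (0 < n)%N by lia.
apply: (close_freq_bounds x y d _ n0).1.
rewrite mulrAC ler_pdivlMr // -!natrM ler_nat.
have := count_predC (close_at x y d) (iota 0 n.+1); rewrite size_iota; lia.
Qed.

Lemma DC2_irreflexive x : ~ DC2_pair f x x.
Proof.
move=> [_ [e [e0 _]]]; apply/negP; rewrite -leNgt.
apply: le_limn_inf; first exact: close_freq_bounded.
exists 1%N => n n0; apply: (close_freq_bounds x x e _ n0).2.
rewrite mul1r ler_nat (@eq_count _ _ predT) ?count_predT ?size_iota // => k.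
by rewrite /close_at mdistxx e0.
Qed.

Lemma mdist_le_diam B x y : (forall x y : X, mdist x y <= B) -> mdist x y <= diam X.
Proof.
move=> hB; apply: ub_le_sup; last by exists (x, y).
by exists B => _ [[z t] _ <-].
Qed.

End frequencies.

(** * The shift on the tree *)

Section shift.
Variables (R : realType) (E : set (nat -> bool)).
Hypothesis E_shift : forall a : nat -> bool, E a -> E (fun j => a j.+1).
Local Notation tree := (@tree R E).
Implicit Types x y : tree.

Lemma tree_shift_height_ge0 x : 0 <= Num.min 1 (2 * height x).
Proof. by rewrite le_min ler01 mulr_ge0 ?height_ge0. Qed.

Lemma tree_shift_height_le1 x : Num.min 1 (2 * height x) <= 1.
Proof. by rewrite ge_min lexx. Qed.

Lemma tree_shift_cut x j : wt j <= Num.min 1 (2 * height x) -> branch x j.+1 = false.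
Proof.
rewrite le_min => /andP[_ h]; apply: branch_cut.
by rewrite -(ler_pM2l (ltr0Sn R 1)) -wtS.
Qed.

(** Dropping the first entry doubles the weights of the others, hence the heights. *)
Definition tree_shift x : tree :=
  Tree (E_shift (branch_in x)) (tree_shift_height_ge0 x)
    (tree_shift_height_le1 x) (@tree_shift_cut x).

Lemma tree_shift_lipschitz x y : mdist (tree_shift x) (tree_shift y) <= 2 * mdist x y.
Proof.
have [h1 h2 h3] := meet_height_ge x y; rewrite !mdistE /=.
have m1 := meet_height_le1 (tree_shift x) (tree_shift y).
have m2 : meet_height (tree_shift x) (tree_shift y) <= 2 * meet_height x y.
  apply: meet_height_le => /=; [| |by apply: le_trans (sdist_shift _ _ _) _; lra].
    by rewrite ge_min; apply/orP; right; lra.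
  by rewrite ge_min; apply/orP; right; lra.
by case: (leP 1 (2 * height x)) => q1; case: (leP 1 (2 * height y)) => q2; lra.
Qed.

Lemma tree_shift_continuous : continuous tree_shift.
Proof.
move=> x; apply/(@metricType_numDomainType.cvgrPdist_lt R tree _ (nbhs x)) => e e0.
apply/nbhs_ballP; exists (e / 2); first by rewrite /= divr_gt0.
by move=> y; rewrite ballEmdist /= => xy; have := tree_shift_lipschitz x y; lra.
Qed.

Lemma branch_iter k x : branch (iter k tree_shift x) = fun j => branch x (k + j)%N.
Proof.
elim: k => [//|k IH]; apply/funext => j.
by rewrite iterS /= IH addSnnS.
Qed.

Lemma height_iter k x : height (iter k tree_shift x) = Num.min 1 (2 ^+ k * height x).
Proof.
elim: k => [|k IH]; first by rewrite mul1r (min_idPr (height_le1 x)).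
rewrite iterS /= IH exprS -mulrA; set v := _ * height x.
have v0 : 0 <= v by rewrite mulr_ge0 ?exprn_ge0 ?height_ge0.
by case: (leP 1 v) => h; [rewrite mulr1 !min_l; lra|].
Qed.

Lemma height_iter1 x : 0 < height x ->
  exists K, forall k, (K <= k)%N -> height (iter k tree_shift x) = 1.
Proof.
move=> /wt_small [K hK]; exists K => k /hK hk; rewrite height_iter min_l //.
have k0 : 0 < 2 ^+ k :> R by rewrite exprn_gt0.
by rewrite mulrC -ler_pdivrMr // mul1r -exprVn ltW.
Qed.

Lemma height1_eq x y : height x = 1 -> height y = 1 -> x = y.
Proof.
move=> hx hy; apply: tree_eq; last by rewrite hx.
by apply/funext => j; rewrite !branch_cut ?hx ?hy ?wt_le1.
Qed.

Lemma height_iter0 k x : height x = 0 -> height (iter k tree_shift x) = 0.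
Proof. by move=> x0; rewrite height_iter x0 mulr0 min_r. Qed.

Lemma dist_ends x y : height x = 0 -> height y = 0 ->
  mdist x y = 2 * sdist (branch x) (branch y).
Proof.
by move=> x0 y0; rewrite mdistE /meet_height x0 y0 maxxx (max_idPr (sdist_ge0 _ _ _)) !subr0.
Qed.

Lemma dist_end_apex x y : height x = 0 -> height y = 1 -> mdist x y = 1.
Proof.
move=> x0 y1; rewrite mdistE /meet_height x0 y1 (max_idPr (@ler01 R)).
by rewrite (max_idPl (sdist_le1 _ _ _)); lra.
Qed.

Lemma end_cut (a : nat -> bool) j : wt j <= (0 : R) -> a j = false.
Proof. by rewrite leNgt wt_gt0. Qed.

Definition tree_end a (Ea : E a) : tree := Tree Ea (lexx 0) ler01 (@end_cut a).

Lemma apex_cut (j : nat) : wt j <= (1 : R) -> (fun=> false) j = false.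
Proof. by []. Qed.

Definition apex (E0 : E (fun=> false)) : tree := Tree E0 ler01 (lexx 1) apex_cut.

Lemma one_le_diam (E0 : E (fun=> false)) : 1 <= diam tree.
Proof.
rewrite -(@dist_end_apex (tree_end E0) (apex E0)) //.
exact/(mdist_le_diam _ _ (@dist_le2 _ _)).
Qed.

Lemma close_ends x y (e : R) : height x = 0 -> height y = 0 -> 0 < e ->
  exists L, forall k, (forall i, (i < L)%N -> branch x (k + i)%N = branch y (k + i)%N) ->
    close_at tree_shift x y e k.
Proof.
move=> x0 y0 e0; have [L hL] := @wt_small R (e / 4) ltac:(lra).
exists L => k agree; rewrite /close_at dist_ends ?height_iter0 //.
suff : sdist (branch (iter k tree_shift x)) (branch (iter k tree_shift y)) <= e / 4 by lra.
apply: sdist_le => [|j]; first by lra.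
rewrite !branch_iter => nj; apply/ltW/hL; rewrite leqNgt; apply/negP => jL.
by apply: nj; exact: agree.
Qed.

Lemma far_ends x y k : height x = 0 -> height y = 0 -> branch x k <> branch y k ->
  ~~ close_at tree_shift x y 1 k.
Proof.
move=> x0 y0 nk; rewrite /close_at dist_ends ?height_iter0 // -leNgt.
suff : (1 : R) <= sdist (branch (iter k tree_shift x)) (branch (iter k tree_shift y)) by lra.
by rewrite -[leLHS](@wt0 R); apply: wt_le_sdist; rewrite !branch_iter addn0.
Qed.

End shift.

(** For each [m] the residue can be taken below [period m], so [windowed] is an
intersection of finite unions of closed sets. *)
Lemma windowed_closed : closed (windowed : set cantor_space).
Proof.
have -> : (windowed : set cantor_space) = \bigcap_m \bigcup_(c in `I_(period m))
    \bigcap_(k in [set k | k = c %[mod period m]]) \bigcap_(i in [set i | (i < m)%N])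
      [set a : cantor_space | a (k + i)%N = false].
  apply/seteqP; split=> a wa m.
    move=> _; have [c hc] := wa m; exists (c %% period m)%N => /=.
      by rewrite ltn_mod period_gt0.
    by move=> k /= kc i /= im; apply: hc => //; rewrite kc modn_mod.
  by have [c _ hc] := wa m I; exists c => k kc i im; exact: hc.
apply: closed_bigI => m _; apply: closed_bigcup => [|c _]; first exact: finite_II.
do 2![apply: closed_bigI => ? _].
apply: (@preimage_closed _ _ _ [set false]); last exact: discrete_closed.
by move=> ? _; exact: (@proj_continuous nat (fun=> bool)).
Qed.

(** * Uncountable DC2 set, no DC1 pair *)

Section example.
Variable R : realType.

Local Notation X := (@tree R windowed).
Local Notation f := (@tree_shift R windowed windowed_shift).

(** Two ends agree often because of their common windows; two points of positive
height meet at the apex; an end and a point of positive height are eventually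
at distance 1, so they are not even proximal. *)
Lemma no_DC1_pair (x y : X) : ~ DC1_pair f x y.
Proof.
have mixed (u v : X) : height u = 0 -> 0 < height v ->
    exists K, forall k, (K <= k)%N -> mdist (iter k f u) (iter k f v) = 1.
  move=> u0 /(height_iter1 windowed_shift) [K hK]; exists K => k /hK vk.
  by apply: dist_end_apex => //; exact: height_iter0.
have far (u v : X) : (exists K, forall k, (K <= k)%N ->
    mdist (iter k f u) (iter k f v) = 1) -> ~ DC1_pair f u v.
  move=> [K hK] [/(_ 1 ltr01 (@one_le_diam R _ windowed0)) + _].
  have : Phi_sup f u v 1 <= 2^-1.
    by apply: (@Phi_sup_far _ _ _ _ _ _ K) => k /hK; rewrite /close_at => ->; rewrite ltxx.
  by lra.
have [x0|x0] := eqVneq (height x) 0; have [y0|y0] := eqVneq (height y) 0.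
- move=> [_ [e [e0 _]]]; apply/eqP; rewrite gt_eqF //.
  have [L hL] := close_ends windowed_shift x0 y0 e0.
  have [P [c [P0 hP]]] := windowed_common L (branch_in x) (branch_in y).
  by apply: (@Phi_inf_gt0 _ _ _ _ _ _ P c 0) => // k _ kc; apply: hL => i; exact: hP.
- by apply/far/mixed => //; rewrite lt_neqAle eq_sym y0 height_ge0.
- apply: far; have [|K hK] := mixed y x y0; first by rewrite lt_neqAle eq_sym x0 height_ge0.
  by exists K => k /hK; rewrite metric_sym.
- move=> [_ [e [e0 _]]]; apply/eqP; rewrite gt_eqF //.
  have [|K hK] := @height_iter1 _ _ windowed_shift x.
    by rewrite lt_neqAle eq_sym x0 height_ge0.
  have [|K' hK'] := @height_iter1 _ _ windowed_shift y.
    by rewrite lt_neqAle eq_sym y0 height_ge0.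
  apply: (@Phi_inf_gt0 _ _ _ _ _ _ 1 0 (maxn K K')) => // k.
  rewrite geq_max => /andP[/hK hx /hK' hy] _.
  by rewrite /close_at (height1_eq hx hy) mdistxx.
Qed.

Definition coded_end c : X := tree_end R (coded_windowed c).

Lemma coded_end_DC2 c d : c 0%N = false -> d 0%N = false -> c <> d ->
  DC2_pair f (coded_end c) (coded_end d).
Proof.
move=> c0 d0 cd; split.
  move=> e e0 _; apply: Phi_sup_eq1 => q N.
  have [L hL] := @close_ends _ _ windowed_shift (coded_end c) (coded_end d) e erefl erefl e0.
  have [n Nn hn] := count_close_coded c0 d0 q L N; exists n => //.
  apply: leq_trans hn; rewrite leq_mul2l; apply/orP; right; apply: sub_count => k /=.
  apply: contraR => /existsPn agree; apply: hL => i iL.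
  by have := agree (Ordinal iL); rewrite negbK => /eqP.
exists 1; split; [exact: ltr01|exact: one_le_diam windowed0|].
have [i cdi] : exists i, c i <> d i.
  by apply/existsNP => h; apply: cd; apply/funext.
apply: Phi_inf_lt1 => N; have [n Nn hn] := count_far_coded cdi N; exists n => //.
apply: leq_trans hn _; rewrite leq_mul2l; apply/orP; right; apply: sub_count => k /eqP cdk.
exact: far_ends.
Qed.

Definition coded_ends : set X := [set coded_end c | c in [set c | c 0%N = false]].

Lemma coded_ends_DC2 : DC2_set f coded_ends.
Proof.
move=> _ _ [c c0 <-] [d d0 <-] cd; apply: coded_end_DC2 => // e.
by apply: cd; rewrite e.
Qed.

Lemma coded_end_inj c d : c 0%N = false -> d 0%N = false ->
  coded_end c = coded_end d -> c = d.
Proof.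
move=> c0 d0 cd; apply: contrapT => /(coded_end_DC2 c0 d0); rewrite cd.
exact: DC2_irreflexive.
Qed.

(** Cantor's diagonal argument; the entry 0 is reserved, so the diagonal starts at 1. *)
Lemma coded_ends_uncountable : ~ countable coded_ends.
Proof.
move=> /countable_injP [h hinj].
pose d (j : nat) := if j is n.+1 then
  `[< forall c, c 0%N = false -> h (coded_end c) = n -> c n.+1 = false >] else false.
have d0 : d 0%N = false by [].
pose n := h (coded_end d).
case dn : (d n.+1); move: (dn); rewrite /=.
  by move=> /asboolP /(_ d d0 erefl); rewrite dn.
move=> /negbT /asboolPn; apply => c c0 cn.
suff -> : c = d by exact: dn.
apply: coded_end_inj => //.
by apply: hinj => //; apply/mem_set; [exists c|exists d].
Qed.

End example.

Theorem theorem3 (R : realType) :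
  (exists (X : metricType R) (f : X -> X),
     [/\ dendrite X, continuous f,
         (exists x y : X, DC2_pair f x y) &
         ~ (exists x y : X, DC1_pair f x y)])
  /\
  (exists (X : metricType R) (f : X -> X),
     [/\ dendrite X, continuous f,
         (exists S : set X, ~ countable S /\ DC2_set f S) &
         ~ (exists S : set X, ~ countable S /\ DC1_set f S)]).
Proof.
have dX := tree_dendrite windowed_hereditary (@apex R _ windowed0) windowed_closed.
have cf := @tree_shift_continuous R _ windowed_shift.
split; exists (@tree R windowed), (tree_shift windowed_shift); split=> //.
- exists (coded_end R (fun=> false)), (coded_end R (fun j => j == 1%N)).
  by apply: coded_end_DC2 => // /(congr1 (@^~ 1%N)).
- by move=> [x [y]]; exact: no_DC1_pair.
- by exists (@coded_ends R); split; [exact: coded_ends_uncountable|exact: coded_ends_DC2].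
- move=> [S [uS SDC1]]; apply: uS.
  have [[x Sx]|nS] := pselect (S !=set0); last first.
    by rewrite (_ : S = set0) // -subset0 => z Sz; apply: nS; exists z.
  apply: (sub_countable _ (countable1 x)); apply: subset_card_le => y Sy /=.
  by apply: contrapT => yx; exact: no_DC1_pair (SDC1 _ _ Sy Sx yx).
Qed.
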